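(* Any split abelian extension of $3$-Hom-Lie algebras is isomorphic to a generalized semidirect product $3$-Hom-Lie algebra. That is, if $0\to V\xrightarrow{i}\hat{\mathfrak g}\xrightarrow{p}\mathfrak g\to0$ is a split abelian extension of a $3$-Hom-Lie algebra $(\mathfrak g,[\cdot,\cdot,\cdot]_{\mathfrak g},\alpha)$ by $(V,[\cdot,\cdot,\cdot]_V,A)$, then there is a generalized representation $(V;\rho,\nu,A)$ of $\mathfrak g$ such that $\hat{\mathfrak g}$ is isomorphic, as a $3$-Hom-Lie algebra, to the generalized semidirect product $(\mathfrak g\oplus V,[\cdot,\cdot,\cdot]_{(\rho,\nu)},\alpha+A)$.
   Context: All vector spaces are over a field $\mathbb{K}$ of characteristic $0$; $\mathfrak{gl}(V)=\mathrm{End}(V)$. A $3$-Hom-Lie algebra is a triple $(\mathfrak{g},[\cdot,\cdot,\cdot],\alpha)$: a vector space, a trilinear skew-symmetric bracket, and a linear map $\alpha$ with $\alpha[x,y,z]=[\alpha(x),\alpha(y),\alpha(z)]$, satisfying $[\alpha(u),\alpha(v),[x,y,z]]=[[u,v,x],\alpha(y),\alpha(z)]+[\alpha(x),[u,v,y],\alpha(z)]+[\alpha(x),\alpha(y),[u,v,z]]$ for all $x,y,z,u,v$. Morphisms are linear maps preserving brackets and intertwining the structure maps. Extensions. Let $(\mathfrak g,[\cdot,\cdot,\cdot]_{\mathfrak g},\alpha)$, $(V,[\cdot,\cdot,\cdot]_V,A)$, $(\hat{\mathfrak g},[\cdot,\cdot,\cdot]_{\hat{\mathfrak g}},\alpha_{\hat{\mathfrak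 g}})$ be $3$-Hom-Lie algebras. $\hat{\mathfrak g}$ is an extension of $\mathfrak g$ by $V$ if there are morphisms $i:V\to\hat{\mathfrak g}$, $p:\hat{\mathfrak g}\to\mathfrak g$ of $3$-Hom-Lie algebras with $\mathrm{Im}(i)=\mathrm{Ker}(p)$, $\mathrm{Ker}(i)=0$, $\mathrm{Im}(p)=\mathfrak g$ (so $\alpha_{\hat{\mathfrak g}}$ restricts to $A$ on $V$). It is abelian if $[u,v,w]_V=0$ for all $u,v,w\in V$. A splitting is a linear map $\sigma:\mathfrak g\to\hat{\mathfrak g}$ with $p\circ\sigma=\mathrm{id}_{\mathfrak g}$; the abelian extension is split if there is a splitting which is a morphism of $3$-Hom-Lie algebras. Bracket in degree one. For a vector space $W$ with a linear map $\gamma:W\to W$, and a linear map $\Pi:\wedge^3W\to W$ with $\gamma\circ\Pi=\Pi\circ\gamma^{\otimes 3}$, $$[\Pi,\Pi]^{3HL}(a\wedge b,c\wedge d,e)=-2\big(\Pi(\Pi(a,b,c),\gamma d,\gamma e)+\Pi(\gamma c,\Pi(a,b,d),\gamma e)+\Pi(\gamma c,\gamma d,\Pi(a,b,e))-\Pi(\gamma a,\gamma b,\Pi(c,d,e))\big).$$ Generalized representation. Let $\pi$ be the bracket of $\mathfrak g$, extended by zero to $\wedge^3(\mathfrak g\oplus V)$. For $A\in\mathfrak{gl}(V)$ and linear maps $\rho:\wedge^2\mathfrak g\to\mathfrak{gl}(V)$, $\nu:\mathfrak g\to\mathrm{Hom}(\wedge^2V,V)$, put $\overline\rho(x+u,y+v,z+w)=\rho(x,y)(w)+\rho(y,z)(u)+\rho(z,x)(v)$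 and $\overline\nu(x+u,y+v,z+w)=\nu(x)(v\wedge w)+\nu(y)(w\wedge u)+\nu(z)(u\wedge v)$. $(V;\rho,\nu,A)$ is a generalized representation of $\mathfrak g$ if $\Pi=\pi+\overline\rho+\overline\nu$ commutes with $\gamma=\alpha+A$ (where $(\alpha+A)(x+u)=\alpha(x)+A(u)$; i.e. $\gamma\circ\Pi=\Pi\circ\gamma^{\otimes3}$) and $[\Pi,\Pi]^{3HL}=0$. The corresponding generalized semidirect product is $(\mathfrak g\oplus V,[\cdot,\cdot,\cdot]_{(\rho,\nu)},\alpha+A)$ with $[\cdot,\cdot,\cdot]_{(\rho,\nu)}=\pi+\overline\rho+\overline\nu$. *)

(* Defs.v *)
From HB Require Import structures.
From mathcomp Require Import all_boot all_order all_algebra.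

Set Implicit Arguments.
Unset Strict Implicit.
Unset Printing Implicit Defensive.

Import GRing.Theory.
Local Open Scope ring_scope.

Definition trilinear (K : fieldType) (U V W X : lmodType K)
    (f : U -> V -> W -> X) : Prop :=
  [/\ forall v w, linear (fun u => f u v w),
      forall u w, linear (fun v => f u v w)
    & forall u v, linear (fun w => f u v w)].

(* Adjacent transpositions generate S_3; over a field of characteristic 0 a
   skew-symmetric trilinear map is the same thing as a linear map out of the
   third exterior power. *)
Definition skew3 (U : Type) (X : zmodType) (f : U -> U -> U -> X) : Prop :=
  (forall x y z, f y x z = - f x y z) /\ (forall x y z, f x z y = - f x y z).

Definition multiplicative3 (U : Type) (gamma : U -> U) (f : U -> U -> U -> U) :=
  forall x y z, gamma (f x y z) = f (gamma x) (gamma y) (gamma z).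

Definition hom_jacobi3 (U : zmodType) (alpha : U -> U) (br : U -> U -> U -> U) :=
  forall x y z u v,
    br (alpha u) (alpha v) (br x y z) =
      br (br u v x) (alpha y) (alpha z) + br (alpha x) (br u v y) (alpha z)
      + br (alpha x) (alpha y) (br u v z).

(* No finite-dimensionality is assumed. *)
Record homLie3 (K : fieldType) := HomLie3 {
  carrier :> lmodType K;
  bracket : carrier -> carrier -> carrier -> carrier;
  twist : {linear carrier -> carrier};
  bracket_trilinear : trilinear bracket;
  bracket_skew : skew3 bracket;
  twist_bracket : multiplicative3 twist bracket;
  bracket_jacobi : hom_jacobi3 twist bracket
}.

Arguments bracket {K h} x y z.
Arguments twist {K} h.

Definition is_morphism (K : fieldType) (g h : homLie3 K)
    (f : {linear g -> h}) : Prop :=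
  (forall x y z, f (bracket x y z) = bracket (f x) (f y) (f z)) /\
  (forall x, f (twist g x) = twist h (f x)).

Definition isomorphic (K : fieldType) (g h : homLie3 K) : Prop :=
  exists (f : {linear g -> h}) (f' : {linear h -> g}),
    [/\ is_morphism f, is_morphism f', cancel f f' & cancel f' f].

Definition is_extension (K : fieldType) (g V ghat : homLie3 K)
    (i : {linear V -> ghat}) (p : {linear ghat -> g}) : Prop :=
  [/\ is_morphism i, is_morphism p,
      forall y, (exists u, i u = y) <-> p y = 0,
      forall u, i u = 0 -> u = 0
    & forall x, exists y, p y = x].

Definition abelian3 (K : fieldType) (V : homLie3 K) : Prop :=
  forall u v w : V, bracket u v w = 0.

Definition is_splitting (K : fieldType) (g ghat : homLie3 K)
    (p : {linear ghat -> g}) (sigma : {linear g -> ghat}) : Prop :=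
  forall x, p (sigma x) = x.

Definition is_split (K : fieldType) (g ghat : homLie3 K)
    (p : {linear ghat -> g}) : Prop :=
  exists sigma : {linear g -> ghat}, is_splitting p sigma /\ is_morphism sigma.

(* The value of [Pi, Pi]^{3HL} at (a /\ b, c /\ d, e). *)
Definition bracket3HL (K : fieldType) (W : lmodType K) (gamma : W -> W)
    (Pi : W -> W -> W -> W) (a b c d e : W) : W :=
  (- 2%:R : K) *:
    (Pi (Pi a b c) (gamma d) (gamma e) + Pi (gamma c) (Pi a b d) (gamma e)
     + Pi (gamma c) (gamma d) (Pi a b e) - Pi (gamma a) (gamma b) (Pi c d e)).

Section DirectSum.

Variables (K : fieldType) (g : homLie3 K) (V : lmodType K).
Implicit Types (rho : g -> g -> V -> V) (nu : g -> V -> V -> V).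

Definition pi_ext (X Y Z : g * V) : g * V := (bracket X.1 Y.1 Z.1, 0).

Definition rho_bar rho (X Y Z : g * V) : g * V :=
  (0, rho X.1 Y.1 Z.2 + rho Y.1 Z.1 X.2 + rho Z.1 X.1 Y.2).

Definition nu_bar nu (X Y Z : g * V) : g * V :=
  (0, nu X.1 Y.2 Z.2 + nu Y.1 Z.2 X.2 + nu Z.1 X.2 Y.2).

Definition semidirect_bracket rho nu (X Y Z : g * V) : g * V :=
  pi_ext X Y Z + rho_bar rho X Y Z + nu_bar nu X Y Z.

Definition sum_twist (A : {linear V -> V}) (X : g * V) : g * V :=
  (twist g X.1, A X.2).

Fact sum_twist_is_linear A : linear (sum_twist A).
Proof. by move=> k X Y; rewrite /sum_twist /= !linearP. Qed.

HB.instance Definition _ A :=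
  GRing.isLinear.Build K (g * V)%type (g * V)%type _ (sum_twist A)
    (sum_twist_is_linear A).

End DirectSum.

(* rho : /\^2 g -> gl(V) and nu : g -> Hom(/\^2 V, V), in curried form. *)
Record genRep (K : fieldType) (g : homLie3 K) (V : lmodType K)
    (A : {linear V -> V}) := GenRep {
  rho : g -> g -> V -> V;
  nu : g -> V -> V -> V;
  rho_trilinear : trilinear rho;
  rho_skew : forall x y u, rho y x u = - rho x y u;
  nu_trilinear : trilinear nu;
  nu_skew : forall x u v, nu x v u = - nu x u v;
  genRep_twist : multiplicative3 (sum_twist A) (semidirect_bracket rho nu);
  genRep_bracket3HL : forall a b c d e,
    bracket3HL (sum_twist A) (semidirect_bracket rho nu) a b c d e = 0
}.

Section SemidirectProduct.

Variables (K : fieldType) (charK : [pchar K] =i pred0).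
Variables (g : homLie3 K) (V : lmodType K) (A : {linear V -> V}).
Variable R : genRep g A.

Local Notation Pi := (semidirect_bracket (rho R) (nu R)).

Fact semidirect_trilinear : trilinear Pi.
Proof.
have [b1 b2 b3] := bracket_trilinear g.
have [r1 r2 r3] := rho_trilinear R; have [n1 n2 n3] := nu_trilinear R.
have lin2 k (a b c a' b' c' d e f d' e' f' : V) :
    (k *: a + a') + (k *: b + b') + (k *: c + c')
    + ((k *: d + d') + (k *: e + e') + (k *: f + f'))
    = k *: (a + b + c + (d + e + f)) + (a' + b' + c' + (d' + e' + f')).
  rewrite !scalerDr (addrACA (k *: a)) (addrACA (k *: a + k *: b)).
  by rewrite (addrACA (k *: d)) (addrACA (k *: d + k *: e)) [LHS]addrACA.
split=> [Y Z|X Z|X Y] k S T;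
  rewrite /semidirect_bracket /pi_ext /rho_bar /nu_bar;
  congr pair => /=.
- by rewrite b1 !addr0.
- by rewrite !add0r r1 r2 r3 n1 n2 n3 lin2.
- by rewrite b2 !addr0.
- by rewrite !add0r r1 r2 r3 n1 n2 n3 lin2.
- by rewrite b3 !addr0.
- by rewrite !add0r r1 r2 r3 n1 n2 n3 lin2.
Qed.

Fact semidirect_skew : skew3 Pi.
Proof.
have [b1 b2] := bracket_skew g; have r := rho_skew R; have n := nu_skew R.
split=> X Y Z; rewrite /semidirect_bracket /pi_ext /rho_bar /nu_bar;
  congr pair => /=.
- by rewrite !addr0 b1.
- rewrite !add0r !opprD -!r -!n (addrAC (rho R Y.1 X.1 Z.2)).
  by rewrite (addrC (nu R Y.1 X.2 Z.2)).
- by rewrite !addr0 b2.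
- rewrite !add0r !opprD -!r -!n (addrAC (nu R X.1 Z.2 Y.2)).
  by congr (_ + _); rewrite addrC (addrC (rho R X.1 Z.1 Y.2)) addrA.
Qed.

Fact semidirect_jacobi : hom_jacobi3 (sum_twist A) Pi.
Proof.
move=> x y z u v; have := genRep_bracket3HL R u v x y z.
move/eqP; rewrite scaler_eq0 oppr_eq0 -[_ == 0 :> K]negbK.
have -> : 2%:R != 0 :> K by rewrite (pcharf0P K).1.
by rewrite subr_eq0 => /eqP ->.
Qed.

Definition semidirect : homLie3 K :=
  HomLie3 semidirect_trilinear semidirect_skew (genRep_twist R)
    semidirect_jacobi.

End SemidirectProduct.

(* Main.v *)
Require Import Defs.
From mathcomp Require Import all_boot all_order all_algebra.
From HB Require Import structures.

(** Write an element of [g * V] as [(x, u)] and let [sigma] be a splitting that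
    is a morphism. The map [(x, u) |-> sigma x + i u] is a linear bijection
    [g * V -> ghat], because the sequence is exact and [sigma] is a section of
    [p]. Expand [[sigma x + i u, sigma y + i v, sigma z + i w]] into eight
    terms: the term without any [i] is [sigma [x, y, z]] since [sigma] is a
    morphism, the term without any [sigma] vanishes since [V] is abelian, and
    each of the six mixed terms lies in [ker p = im i]. Reading the mixed terms
    with one entry from [V] as [rho] and those with two as [nu], the expansion
    says exactly that the bijection carries the semidirect bracket to the
    bracket of [ghat] (lemma [glue_bracket]); it also intertwines the twists
    (lemma [glue_twist]). So the two identities that define a generalized
    representation need no computation: they are transported along an injective
    map from the multiplicativity and the Hom-Jacobi identity of [ghat]. *)

Set Implicit Arguments.
Unset Strict Implicit.
Unset Printing Implicit Defensive.

Import GRing.Theory.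
Local Open Scope ring_scope.

(** * Trilinear maps *)

Section Trilinear.

Variables (K : fieldType) (U V W X : lmodType K) (f : U -> V -> W -> X).
Hypothesis f_tri : trilinear f.

Lemma trilinearD1 u u' v w : f (u + u') v w = f u v w + f u' v w.
Proof. by case: f_tri => f1 _ _; have := f1 v w 1 u u'; rewrite !scale1r. Qed.

Lemma trilinearD2 u v v' w : f u (v + v') w = f u v w + f u v' w.
Proof. by case: f_tri => _ f2 _; have := f2 u w 1 v v'; rewrite !scale1r. Qed.

Lemma trilinearD3 u v w w' : f u v (w + w') = f u v w + f u v w'.
Proof. by case: f_tri => _ _ f3; have := f3 u v 1 w w'; rewrite !scale1r. Qed.

Lemma trilinear_comp (U' V' W' X' : lmodType K) (a : {linear U' -> U})
    (b : {linear V' -> V}) (c : {linear W' -> W}) (h : {linear X -> X'}) :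
  trilinear (fun u v w => h (f (a u) (b v) (c w))).
Proof.
case: f_tri => f1 f2 f3.
by split=> ? ? k s t; rewrite linearP ?(f1, f2, f3) linearP.
Qed.

End Trilinear.

Lemma skew3_rot (U : Type) (X : zmodType) (f : U -> U -> U -> X) :
  skew3 f -> forall x y z, f x y z = f y z x.
Proof. by case=> f12 f23 x y z; rewrite f12 f23 opprK. Qed.

(** * The linear decomposition of a split extension *)

Section SplitExtension.

Variables (K : fieldType) (g V ghat : homLie3 K).
Variables (i : {linear V -> ghat}) (p : {linear ghat -> g}).
Variable sigma : {linear g -> ghat}.
Hypothesis ext : is_extension i p.
Hypothesis split : is_splitting p sigma.

Lemma extension_projK u : p (i u) = 0.
Proof. by case: ext => _ _ ex _ _; apply/ex; exists u. Qed.

Lemma extension_inj : injective i.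
Proof.
case: ext => _ _ _ ker0 _ u v uv; apply/eqP; rewrite -subr_eq0; apply/eqP.
by apply: ker0; rewrite linearB uv subrr.
Qed.

Lemma split_defect_im y : exists u, i u == y - sigma (p y).
Proof.
case: ext => _ _ ex _ _; have [|u <-] := (ex (y - sigma (p y))).2.
  by rewrite linearB split subrr.
by exists u.
Qed.

(** The retraction of [i] complementary to [sigma]. The choice operator of [V]
    picks the preimage, which is unique since [i] is injective. *)
Definition retraction y : V := xchoose (split_defect_im y).

Lemma retractionE y : i (retraction y) = y - sigma (p y).
Proof. exact/eqP/(xchooseP (split_defect_im y)). Qed.

Fact retraction_is_linear : linear retraction.
Proof.
move=> k y z; apply: extension_inj.
rewrite (linearP i) !retractionE (linearP p) (linearP sigma).
rewrite scalerBr opprD.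
exact: addrACA.
Qed.

HB.instance Definition _ :=
  GRing.isLinear.Build K ghat V _ retraction retraction_is_linear.

Lemma retraction_kerK y : p y = 0 -> i (retraction y) = y.
Proof. by move=> py0; rewrite retractionE py0 linear0 subr0. Qed.

Definition glue (X : (g * V)%type) : ghat := sigma X.1 + i X.2.

Fact glue_is_linear : linear glue.
Proof. by move=> k X Y; rewrite /glue !linearP scalerDr addrACA. Qed.

HB.instance Definition _ :=
  GRing.isLinear.Build K (g * V)%type ghat _ glue glue_is_linear.

Definition unglue (y : ghat) : (g * V)%type := (p y, retraction y).

Fact unglue_is_linear : linear unglue.
Proof. by move=> k y z; rewrite /unglue !linearP. Qed.

HB.instance Definition _ :=
  GRing.isLinear.Build K ghat (g * V)%type _ unglue unglue_is_linear.

Lemma unglueK : cancel unglue glue.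
Proof. by move=> y; rewrite /glue /= retractionE addrC subrK. Qed.

Lemma glueK : cancel glue unglue.
Proof.
case=> x u; have px : p (sigma x + i u) = x.
  by rewrite linearD split extension_projK addr0.
congr pair => //=; apply: extension_inj.
by rewrite retractionE px addrC addKr.
Qed.

(** * The generalized representation of a split abelian extension *)

Hypothesis abV : abelian3 V.
Hypothesis sigma_mor : is_morphism sigma.

Definition ext_rho (x y : g) (u : V) : V :=
  retraction (bracket (sigma x) (sigma y) (i u)).

Definition ext_nu (x : g) (u v : V) : V :=
  retraction (bracket (sigma x) (i u) (i v)).

Let br0 (L : homLie3 K) (x y : L) : bracket x y 0 = 0.
Proof.
apply: (addrI (bracket x y 0)).
by rewrite -(trilinearD3 (bracket_trilinear L)) !addr0.
Qed.

(** Both identities hold because [im i = ker p] is an ideal of [ghat]. *)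
Lemma ext_rhoE x y u : i (ext_rho x y u) = bracket (sigma x) (sigma y) (i u).
Proof.
case: ext => _ [pM _] _ _ _.
by apply: retraction_kerK; rewrite pM extension_projK br0.
Qed.

Lemma ext_nuE x u v : i (ext_nu x u v) = bracket (sigma x) (i u) (i v).
Proof.
case: ext => _ [pM _] _ _ _.
by apply: retraction_kerK; rewrite pM !extension_projK br0.
Qed.

Lemma ext_rho_trilinear : trilinear ext_rho.
Proof.
exact: (trilinear_comp (bracket_trilinear ghat) sigma sigma i retraction).
Qed.

Lemma ext_nu_trilinear : trilinear ext_nu.
Proof.
exact: (trilinear_comp (bracket_trilinear ghat) sigma i i retraction).
Qed.

Lemma ext_rho_skew x y u : ext_rho y x u = - ext_rho x y u.
Proof. by rewrite /ext_rho (bracket_skew ghat).1 linearN. Qed.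

Lemma ext_nu_skew x u v : ext_nu x v u = - ext_nu x u v.
Proof. by rewrite /ext_nu (bracket_skew ghat).2 linearN. Qed.

Local Notation Pi := (semidirect_bracket ext_rho ext_nu).

(** The eight-term expansion; the cyclic order of the arguments in the
    semidirect bracket matches the invariance of a skew bracket under
    rotation, so no signs appear. *)
Lemma glue_bracket X Y Z : glue (Pi X Y Z) = bracket (glue X) (glue Y) (glue Z).
Proof.
have [[iM _] _ _ _ _] := ext; have tri := bracket_trilinear ghat.
have rot := skew3_rot (bracket_skew ghat).
rewrite /glue /= !(trilinearD1 tri, trilinearD2 tri, trilinearD3 tri).
rewrite -[in RHS]iM abV linear0 addr0.
rewrite !addr0 !add0r !linearD !ext_rhoE !ext_nuE sigma_mor.1.
(* The cyclic entries of [rho_bar] and [nu_bar] are rotated back to X, Y, Z. *)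
rewrite -(rot (i X.2) (sigma Y.1) (sigma Z.1)) (rot (sigma Z.1) (sigma X.1)).
rewrite (rot (sigma Y.1) (i Z.2)) (rot (i Z.2) (i X.2)).
rewrite (rot (sigma Z.1) (i X.2) (i Y.2)).
by rewrite !addrA [LHS](ACl (1*2*4*5*3*6*7)).
Qed.

Lemma glue_twist X : glue (sum_twist (twist V) X) = twist ghat (glue X).
Proof.
by case: ext => -[_ iA] _ _ _ _; rewrite /glue linearD iA sigma_mor.2.
Qed.

Lemma ext_multiplicative : multiplicative3 (sum_twist (twist V)) Pi.
Proof.
move=> X Y Z; apply: (can_inj glueK).
by rewrite glue_twist !glue_bracket twist_bracket !glue_twist.
Qed.

Lemma ext_bracket3HL a b c d e :
  bracket3HL (sum_twist (twist V)) Pi a b c d e = 0.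
Proof.
have glueD X Y : glue (X + Y) = glue X + glue Y := linearD glue X Y.
have glueB X Y : glue (X - Y) = glue X - glue Y := linearB glue X Y.
have glueZ k X : glue (k *: X) = k *: glue X := linearZ_LR glue k X.
have glue0 : glue 0 = 0 := linear0 glue.
apply: (can_inj glueK); rewrite /bracket3HL glueZ glueB.
(* Only two additions are split: the semidirect bracket unfolds to a sum, and
   a further step would break it up. *)
rewrite 2!glueD !glue_bracket !glue_twist.
by rewrite (bracket_jacobi (glue c)) subrr scaler0 glue0.
Qed.

Definition ext_genRep : genRep g (twist V) :=
  GenRep ext_rho_trilinear ext_rho_skew ext_nu_trilinear ext_nu_skew
    ext_multiplicative ext_bracket3HL.

End SplitExtension.

(** * The isomorphism *)

Lemma inverse_is_morphism (K : fieldType) (g h : homLie3 K)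
    (f : {linear g -> h}) (f' : {linear h -> g}) :
  is_morphism f -> cancel f f' -> cancel f' f -> is_morphism f'.
Proof.
move=> [fM fA] fK f'K; split=> *; apply: (can_inj fK).
  by rewrite fM !f'K.
by rewrite fA !f'K.
Qed.

Theorem proposition4p3 (K : fieldType) (charK : [pchar K]%R =i pred0)
    (g V ghat : homLie3 K) (i : {linear V -> ghat}) (p : {linear ghat -> g}) :
  is_extension i p -> abelian3 V -> is_split p ->
  exists R : genRep g (twist V), isomorphic ghat (semidirect charK R).
Proof.
move=> ext abV [sigma [split sigma_mor]].
exists (ext_genRep ext split abV sigma_mor).
pose S := semidirect charK (ext_genRep ext split abV sigma_mor).
pose f : {linear S -> ghat} := @glue K g V ghat i sigma.
pose f' : {linear ghat -> S} := unglue ext split.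
have fK : cancel f f' := glueK ext split.
have f'K : cancel f' f := unglueK ext split.
have f_mor : is_morphism f.
  split=> [X Y Z|X]; first exact: (glue_bracket ext split abV sigma_mor).
  exact: (glue_twist ext sigma_mor).
by exists f', f; split=> //; apply: inverse_is_morphism f_mor fK f'K.
Qed.
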